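(* Let $S\subseteq\mathbb{Z}^2$ and let $\alpha,\beta$ be reals with $\beta\le 3\cdot 2-3=3$. Then $\vartheta(R(S),\alpha,\beta+2)\ge\vartheta(S,\alpha,\beta)$.
   Context: Graph $\mathbf{G}$ on $\mathbb{Z}^2$: each $p$ is adjacent to $p\pm(1,0)$, $p\pm(0,1)$, $p+(-1,1)$, $p+(1,-1)$; connectedness and paths refer to $\mathbf{G}$ (paths ''in $S$'' use only vertices of $S$). Tiles: $Q(p)=\{p,p+(1,0),p+(0,1)\}$; $R(S)=\{p:|S\cap Q(p)|\ge 2\}$ (Toom's rule). Triangles: for reals $a,b,c$, $L(a,b,c)=\{(x,y): -x\le a,\ -y\le b,\ x+y\le c\}$, $\mathrm{span}(L(a,b,c))=a+b+c$, $D(L(a,b,c),d)=L(a-d,b-d,c-d)$. For $E\subseteq\mathbb{Z}^2$, $\mathrm{span}(E,d)$ is the minimum of $\sum_{I\in\mathcal{I}}\mathrm{span}(I)$ over finite sets $\mathcal{I}$ of triangles with $E\subseteq\bigcup_{I\in\mathcal{I}}D(I,d)$, and $\mathrm{Span}(E)=\mathrm{span}(E,2)$ (the deflation constant is $2$). A triple $(C,A_1,A_2)$ of pairwise disjoint subsets of $S$ is a cut of $S$ with parameters $|C|,m$ if every path in $S$ from $A_1$ to $A_2$ passes through an element of $C$, and $m=\min_{j=1,2}\mathrm{Span}(A_j\cup C)$; it is connected if both $A_1\cup C$ and $A_2\cup C$ are connected. $\vartheta(S,\alpha,\beta)$ is the smallest $k$ such that $S$ has a connected cut with parameters $k,m$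 with $m>\alpha k+\beta$ ($\infty$ if none). *)

(* Defs.v *)
From Stdlib Require Import ZArith Reals List ClassicalEpsilon.
From Coquelicot Require Import Coquelicot.
Set Implicit Arguments.

Definition pt := (Z * Z)%type.
Definition pset := pt -> Prop.

Definition adj (p q : pt) : Prop :=
  let d := ((fst q - fst p)%Z, (snd q - snd p)%Z) in
  d = (1%Z, 0%Z) \/ d = ((-1)%Z, 0%Z) \/ d = (0%Z, 1%Z) \/ d = (0%Z, (-1)%Z) \/
  d = ((-1)%Z, 1%Z) \/ d = (1%Z, (-1)%Z).

Fixpoint adj_chain (x : pt) (l : list pt) : Prop :=
  match l with
  | nil => True
  | y :: l' => adj x y /\ adj_chain y l'
  end.

Definition path_in (S : pset) (x : pt) (l : list pt) : Prop :=
  adj_chain x l /\ List.Forall S (x :: l).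

Definition connected (S : pset) : Prop :=
  forall x y, S x -> S y -> exists l, path_in S x l /\ last l x = y.

Definition Q (p : pt) : list pt :=
  p :: ((fst p + 1)%Z, snd p) :: (fst p, (snd p + 1)%Z) :: nil.

Definition Rtoom (S : pset) : pset := fun p =>
  let p1 := ((fst p + 1)%Z, snd p) in
  let p2 := (fst p, (snd p + 1)%Z) in
  (S p /\ S p1) \/ (S p /\ S p2) \/ (S p1 /\ S p2).

Definition tri := (R * R * R)%type.
Definition tri_span (t : tri) : R := let '(a, b, c) := t in (a + b + c)%R.
(* a triangle is a (nonempty) L(a,b,c): a+b+c >= 0 *)
Definition is_triangle (t : tri) : Prop := (0 <= tri_span t)%R.
Definition inL (t : tri) (p : pt) : Prop :=
  let '(a, b, c) := t in
  (- IZR (fst p) <= a /\ - IZR (snd p) <= b /\ IZR (fst p) + IZR (snd p) <= c)%R.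
Definition Defl (t : tri) (d : R) : tri :=
  let '(a, b, c) := t in ((a - d)%R, (b - d)%R, (c - d)%R).

Definition sum_span (l : list tri) : R :=
  fold_right (fun t acc => (tri_span t + acc)%R) 0%R l.

Definition cover_costs (E : pset) (d : R) : R -> Prop := fun s =>
  exists l : list tri, NoDup l /\ List.Forall is_triangle l /\
    (forall p, E p -> exists t, In t l /\ inL (Defl t d) p) /\
    s = sum_span l.

(* span(E,d): the minimum (infimum; +oo if there is no cover) *)
Definition span_set (E : pset) (d : R) : Rbar := Glb_Rbar (cover_costs E d).
Definition Span (E : pset) : Rbar := span_set E 2%R.

Definition card_is (C : pset) (k : nat) : Prop :=
  exists l : list pt, NoDup l /\ length l = k /\ forall x, C x <-> In x l.

Definition setU (A B : pset) : pset := fun x => A x \/ B x.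

Definition is_cut (S C A1 A2 : pset) : Prop :=
  (forall x, C x -> S x) /\ (forall x, A1 x -> S x) /\ (forall x, A2 x -> S x) /\
  (forall x, ~ (C x /\ A1 x)) /\ (forall x, ~ (C x /\ A2 x)) /\
  (forall x, ~ (A1 x /\ A2 x)) /\
  (forall x l, path_in S x l -> A1 x -> A2 (last l x) -> List.Exists C (x :: l)).

Definition has_conn_cut (S : pset) (k : nat) (m : Rbar) : Prop :=
  exists C A1 A2, is_cut S C A1 A2 /\ card_is C k /\
    m = Rbar_min (Span (setU A1 C)) (Span (setU A2 C)) /\
    connected (setU A1 C) /\ connected (setU A2 C).

Definition good_k (S : pset) (alpha beta : R) (k : nat) : Prop :=
  exists m : Rbar, has_conn_cut S k m /\ Rbar_lt (Finite (alpha * INR k + beta)%R) m.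

(* vartheta(S,alpha,beta) in nat + {oo} (None = oo) *)
Definition vartheta (S : pset) (alpha beta : R) : option nat :=
  match excluded_middle_informative (exists k, good_k S alpha beta k) with
  | left _ => Some (epsilon (inhabits 0%nat)
       (fun k => good_k S alpha beta k /\
                 forall j, (j < k)%nat -> ~ good_k S alpha beta j))
  | right _ => None
  end.

Definition oge (x y : option nat) : Prop :=
  match x, y with
  | None, _ => True
  | Some _, None => False
  | Some a, Some b => (b <= a)%nat
  end.

(* Main.v *)
Require Import Defs.
From Stdlib Require Import ZArith Reals List Lia Lra Classical ClassicalEpsilon.
From Coquelicot Require Import Coquelicot.

(** For a connected nonempty set, overlapping or adjacent deflated triangles of
    a cover can be merged at no cost, so its Span is 6 plus the span of the
    smallest integral triangle around it.  If R(S) is disconnected then so is S,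
    and two single points of S form a cut with k = 0, as 6 > beta.  If
    alpha + beta < 6, one point of S is a cut with k = 1.  Otherwise take a cut
    of R(S) with the least k >= 1.  Splitting A_j + C into two connected pieces
    that are joined only through pairs of elements of C would give two smaller
    cuts; both pieces would then be small, and so would A_j + C, because
    beta <= 3.  Hence no such splitting exists: A_j + C is connected by steps
    that involve A_j and pass through points of S, and every tile of C meets
    both shadows U_j = S /\ Q(A_j).  Choosing in each tile of C the point that
    is in the minority with respect to U_1 gives a cut C' of S with at most k
    points, and A_j + C lies within the triangle of U_j + C' enlarged by 2. *)

(** * Adjacency, tiles and Toom's rule *)

Lemma adjE (a b c d : Z) : adj (a, b) (c, d) <->
  ((c = a + 1 /\ d = b) \/ (c = a - 1 /\ d = b) \/ (c = a /\ d = b + 1) \/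
   (c = a /\ d = b - 1) \/ (c = a - 1 /\ d = b + 1) \/ (c = a + 1 /\ d = b - 1))%Z.
Proof.
unfold adj; simpl; split; intros H.
- destruct H as [H|[H|[H|[H|[H|H]]]]]; injection H; lia.
- destruct H as [H|[H|[H|[H|[H|H]]]]];
    [left|right;left|do 2 right;left|do 3 right;left|do 4 right;left|do 5 right];
    f_equal; lia.
Qed.

Lemma in_QE (a b c d : Z) : In (c, d) (Q (a, b)) <->
  ((c = a /\ d = b) \/ (c = a + 1 /\ d = b) \/ (c = a /\ d = b + 1))%Z.
Proof.
unfold Q; simpl; split; intros H.
- destruct H as [H|[H|[H|[]]]]; injection H; lia.
- destruct H as [H|[H|H]]; [left|right;left|do 2 right;left]; f_equal; lia.
Qed.

Lemma pt_eqE (a b c d : Z) : (a, b) = (c, d) :> pt <-> (a = c /\ b = d)%Z.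
Proof. split; [intros H; injection H; auto|intros [-> ->]; reflexivity]. Qed.

Lemma adj_sym (p q : pt) : adj p q -> adj q p.
Proof. destruct p, q; rewrite !adjE; lia. Qed.

Lemma Q_clique (p u v : pt) : In u (Q p) -> In v (Q p) -> u = v \/ adj u v.
Proof. destruct p, u, v; rewrite !in_QE, adjE, pt_eqE; lia. Qed.

Lemma Q_meet (p q v : pt) : In v (Q p) -> In v (Q q) -> p = q \/ adj p q.
Proof. destruct p, q, v; rewrite !in_QE, adjE, pt_eqE; lia. Qed.

Lemma adj_tile (u w : pt) : adj u w -> exists p, In u (Q p) /\ In w (Q p).
Proof.
destruct u as [x y], w as [x' y']; rewrite adjE; intros H.
(* The corner of the tile is the coordinatewise minimum; for a diagonal edge it is the third
   point. *)
exists (Z.min x x', Z.min y y'); rewrite !in_QE; lia.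
Qed.

Lemma Rtoom_of_two (S : pset) (p u w : pt) :
  S u -> S w -> u <> w -> In u (Q p) -> In w (Q p) -> Rtoom S p.
Proof.
intros Su Sw ne [<-|[<-|[<-|[]]]] [<-|[<-|[<-|[]]]]; unfold Rtoom; tauto.
Qed.

Lemma Rtoom_point (S : pset) (p : pt) : Rtoom S p -> exists v, In v (Q p) /\ S v.
Proof.
unfold Rtoom, Q; intros [[H _]|[[H _]|[H _]]];
  [exists p|exists p|exists (fst p + 1, snd p)%Z]; simpl; auto.
Qed.

(** Adjacent tiles always share a lattice point, but it may lie outside [S]; asking for it in [S]
    keeps the link visible when tiles are replaced by points. On R(S) the relation is reflexive. *)
Definition sadj (S : pset) (p q : pt) : Prop :=
  exists v, S v /\ In v (Q p) /\ In v (Q q).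

Lemma sadj_sym (S : pset) (p q : pt) : sadj S p q -> sadj S q p.
Proof. intros (v & ? & ? & ?); exists v; auto. Qed.

Lemma sadj_adj (S : pset) (p q : pt) : sadj S p q -> p = q \/ adj p q.
Proof. intros (v & _ & Hp & Hq); exact (Q_meet _ _ _ Hp Hq). Qed.

Lemma RtoomE (S : pset) (x y : Z) : Rtoom S (x, y) <->
  (S (x, y) /\ S (x + 1, y)%Z) \/ (S (x, y) /\ S (x, y + 1)%Z) \/
  (S (x + 1, y)%Z /\ S (x, y + 1)%Z).
Proof. reflexivity. Qed.

(* When the common point v of the two tiles is missing from S, the remaining
   points of the tiles are in S and two of them lie in a third tile. *)
Lemma adj_sadj (S : pset) (p q : pt) : adj p q -> Rtoom S p -> Rtoom S q ->
  sadj S p q \/ exists r, Rtoom S r /\ sadj S p r /\ sadj S r q.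
Proof.
assert (bridge : forall (p q : pt) v b b' r, In v (Q p) -> In v (Q q) ->
  In b (Q p) -> In b (Q r) -> In b' (Q q) -> In b' (Q r) -> b <> b' ->
  (S v \/ (S b /\ S b')) ->
  sadj S p q \/ exists r, Rtoom S r /\ sadj S p r /\ sadj S r q).
{ intros p0 q0 v b b' r H1 H2 H3 H4 H5 H6 ne [Sv|[Sb Sb']].
  - left; exists v; auto.
  - right; exists r; split; [|split].
    + exact (Rtoom_of_two _ _ _ _ Sb Sb' ne H4 H6).
    + exists b; auto.
    + exists b'; auto. }
assert (main : forall x y x' y', Rtoom S (x, y) -> Rtoom S (x', y') ->
  ((x' = x + 1 /\ y' = y) \/ (x' = x /\ y' = y + 1) \/ (x' = x + 1 /\ y' = y - 1))%Z ->
  sadj S (x, y) (x', y') \/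
  exists r, Rtoom S r /\ sadj S (x, y) r /\ sadj S r (x', y')).
{ intros x y x' y' Tp Tq H; rewrite RtoomE in Tp, Tq.
  destruct H as [[-> ->]|[[-> ->]|[-> ->]]].
  - apply (bridge _ _ (x + 1, y)%Z (x, y + 1)%Z (x + 1, y + 1)%Z (x, y + 1)%Z);
      rewrite ?in_QE, ?pt_eqE; try lia; tauto.
  - apply (bridge _ _ (x, y + 1)%Z (x + 1, y)%Z (x + 1, y + 1)%Z (x + 1, y)%Z);
      rewrite ?in_QE, ?pt_eqE; try lia; tauto.
  - replace (y - 1 + 1)%Z with y in Tq by lia.
    apply (bridge _ _ (x + 1, y)%Z (x, y)%Z (x + 1, y - 1)%Z (x, y - 1)%Z);
      rewrite ?in_QE, ?pt_eqE; try lia; tauto. }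
destruct p as [x y], q as [x' y']; rewrite adjE; intros H Tp Tq.
assert (D : ((x' = x + 1 /\ y' = y) \/ (x' = x /\ y' = y + 1) \/ (x' = x + 1 /\ y' = y - 1)
  \/ (x = x' + 1 /\ y = y') \/ (x = x' /\ y = y' + 1) \/ (x = x' + 1 /\ y = y' - 1))%Z)
  by lia.
clear H; destruct D as [D|[D|[D|D]]]; try (apply main; auto; fail).
destruct (main x' y' x y Tq Tp D) as [K|(r & Tr & K1 & K2)].
- left; apply sadj_sym; exact K.
- right; exists r; auto using sadj_sym.
Qed.

(** * Connectedness, paths and reachability *)

(* Connectedness by e-steps inside E, stated as an induction principle. *)
Definition conn_by (e : pt -> pt -> Prop) (E : pset) : Prop :=
  forall (P : pset) (x y : pt), E x -> E y -> P x ->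
    (forall u v, E u -> E v -> e u v -> P u -> P v) -> P y.

Inductive reach (E : pset) (x : pt) : pt -> Prop :=
| reach_refl : reach E x x
| reach_step : forall u v, reach E x u -> E v -> adj u v -> reach E x v.

Lemma last_snoc (l : list pt) (x v : pt) : last (l ++ v :: nil) x = v.
Proof. apply last_last. Qed.

Lemma last_default (l : list pt) (y x x' : pt) : last (y :: l) x = last (y :: l) x'.
Proof. revert y; induction l as [|z l IH]; intros y; [reflexivity|exact (IH z)]. Qed.

Lemma last_cons (l : list pt) (x y : pt) : last (y :: l) x = last l y.
Proof. destruct l as [|z l]; [reflexivity|exact (last_default l z x y)]. Qed.

Lemma path_in_snoc (E : pset) (l : list pt) (x v : pt) :
  path_in E x l -> E v -> adj (last l x) v -> path_in E x (l ++ v :: nil).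
Proof.
revert x; induction l as [|y l IH]; intros x [Hc Hf] Ev Ha.
- split; simpl; auto.
  constructor; [exact (Forall_inv Hf)|auto].
- rewrite last_cons in Ha; destruct Hc as [Hxy Hc].
  destruct (IH y) as [Hc' Hf']; auto.
  + split; [exact Hc|exact (Forall_inv_tail Hf)].
  + split; [split; auto|].
    simpl; constructor; [exact (Forall_inv Hf)|exact Hf'].
Qed.

Lemma reach_path (E : pset) (x y : pt) :
  E x -> reach E x y -> exists l, path_in E x l /\ last l x = y.
Proof.
intros Ex H; induction H as [|u v _ [l [Hl <-]] Ev Ha].
- exists nil; split; [split; simpl; auto|reflexivity].
- exists (l ++ v :: nil); split; [apply path_in_snoc; auto|apply last_snoc].
Qed.

Lemma path_closed (E P : pset) (x : pt) (l : list pt) :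
  (forall u v, E u -> E v -> adj u v -> P u -> P v) ->
  path_in E x l -> P x -> P (last l x).
Proof.
intros HP; revert x; induction l as [|y l IH]; intros x [Hc Hf] Px; [exact Px|].
destruct Hc as [Hxy Hc]; rewrite last_cons; apply IH.
- split; [exact Hc|exact (Forall_inv_tail Hf)].
- apply (HP x); auto; [exact (Forall_inv Hf)|].
  exact (Forall_inv (Forall_inv_tail Hf)).
Qed.

Lemma connected_conn_by (E : pset) : connected E <-> conn_by adj E.
Proof.
split.
- intros H P x y Ex Ey Px HP; destruct (H x y Ex Ey) as (l & Hl & <-).
  exact (path_closed _ _ _ _ HP Hl Px).
- intros H x y Ex Ey; apply reach_path; auto.
  apply (H (reach E x) x y); auto.
  + constructor.
  + intros u v _ Ev Ha Hu; exact (reach_step _ _ _ _ Hu Ev Ha).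
Qed.

Lemma reach_closed (E P : pset) (x y : pt) : E x -> P x ->
  (forall u v, E u -> E v -> adj u v -> P u -> P v) -> reach E x y -> E y /\ P y.
Proof.
intros Ex Px HP H; induction H as [|u v _ [Eu Pu] Ev Ha]; eauto.
Qed.

(** Closure under steps runs forwards only; as [adj] is symmetric, the complement is closed too,
    which leads from [y] back to the base point [x]. *)
Lemma conn_by_of_reach (E : pset) (x : pt) :
  E x -> (forall z, E z -> reach E x z) -> conn_by adj E.
Proof.
intros Ex H P y z Ey Ez Py HP.
assert (Px : P x).
{ apply NNPP; intros nPx.
  destruct (reach_closed E (fun w => ~ P w) x y) as [_ K]; auto.
  intros u v Eu Ev Ha nPu Pv; apply nPu, (HP v); auto using adj_sym. }
exact (proj2 (reach_closed E P x z Ex Px HP (H z Ez))).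
Qed.

Lemma conn_by_cross (E P : pset) (x y : pt) : conn_by adj E -> E x -> E y ->
  P x -> ~ P y -> exists u v, E u /\ E v /\ adj u v /\ P u /\ ~ P v.
Proof.
intros H Ex Ey Px nPy; apply NNPP; intros N; apply nPy.
apply (H P x y); auto.
intros u v Eu Ev Ha Pu; apply NNPP; intros nPv; apply N; exists u, v; auto.
Qed.

Lemma conn_by_ext (e : pt -> pt -> Prop) (E F : pset) :
  (forall x, E x <-> F x) -> conn_by e E -> conn_by e F.
Proof.
intros HEF H P x y Fx Fy Px HP; apply (H P x y); auto; try (apply HEF; auto).
intros u v Eu Ev; apply HP; apply HEF; auto.
Qed.

Lemma conn_by_sadj (S : pset) :
  conn_by adj (Rtoom S) -> conn_by (sadj S) (Rtoom S).
Proof.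
intros H P x y Tx Ty Px HP; apply (H P x y); auto.
intros u v Tu Tv Ha Pu.
destruct (adj_sadj S u v Ha Tu Tv) as [K|(r & Tr & K1 & K2)]; eauto.
Qed.

(** * Spans of connected sets and integral triangles *)

Definition inT (a b c : Z) (p : pt) : Prop :=
  (- fst p <= a /\ - snd p <= b /\ fst p + snd p <= c)%Z.

(** On nonempty connected sets this is [x < Span E], by [lt_Span]: a deflation by 2 on each of three
    sides accounts for the 6. *)
Definition big (E : pset) (x : R) : Prop :=
  forall a b c, (forall p, E p -> inT a b c p) -> (x < IZR (a + b + c) + 6)%R.

Definition hull (t t' : tri) : tri :=
  let '(a, b, c) := t in let '(a', b', c') := t' in (Rmax a a', Rmax b b', Rmax c c').

Lemma Rmax_spec (a b : R) :
  ((a <= b /\ Rmax a b = b) \/ (b <= a /\ Rmax a b = a))%R.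
Proof.
destruct (Rle_dec a b) as [H|H]; [left|right].
- split; auto; apply Rmax_right; auto.
- split; [lra|]; apply Rmax_left; lra.
Qed.

Ltac rmax := repeat match goal with
  | |- context [Rmax ?a ?b] =>
      let H := fresh in let K := fresh in
      destruct (Rmax_spec a b) as [[H K]|[H K]]; rewrite K in *; clear K end.

Lemma hull_l (t t' : tri) (p : pt) : inL (Defl t 2) p -> inL (Defl (hull t t') 2) p.
Proof.
destruct t as [[a b] c], t' as [[a' b'] c']; unfold inL, Defl, hull.
rmax; lra.
Qed.

Lemma hull_r (t t' : tri) (p : pt) : inL (Defl t' 2) p -> inL (Defl (hull t t') 2) p.
Proof.
destruct t as [[a b] c], t' as [[a' b'] c']; unfold inL, Defl, hull.
rmax; lra.
Qed.

(** The hull saves [min a a' + min b b' + min c c'], and adjacent points in the deflated triangles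
    make this at least 6 - 1 = 5. *)
Lemma hull_span (t t' : tri) (u v : pt) :
  inL (Defl t 2) u -> inL (Defl t' 2) v -> adj u v ->
  (tri_span (hull t t') <= tri_span t + tri_span t')%R.
Proof.
destruct t as [[a b] c], t' as [[a' b'] c'], u as [x y], v as [x' y'].
rewrite adjE; unfold inL, Defl, hull, tri_span, fst, snd; intros Hu Hv H.
assert (K : ((IZR x' = IZR x + 1 /\ IZR y' = IZR y) \/
  (IZR x' = IZR x - 1 /\ IZR y' = IZR y) \/ (IZR x' = IZR x /\ IZR y' = IZR y + 1) \/
  (IZR x' = IZR x /\ IZR y' = IZR y - 1) \/ (IZR x' = IZR x - 1 /\ IZR y' = IZR y + 1) \/
  (IZR x' = IZR x + 1 /\ IZR y' = IZR y - 1))%R).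
{ rewrite <- !plus_IZR, <- !minus_IZR; intuition (subst; auto 10). }
clear H; rmax; lra.
Qed.

Lemma hull_triangle (t t' : tri) : is_triangle t -> is_triangle (hull t t').
Proof.
destruct t as [[a b] c], t' as [[a' b'] c']; unfold is_triangle, hull, tri_span.
rmax; lra.
Qed.

Lemma sum_span_ge0 (l : list tri) : List.Forall is_triangle l -> (0 <= sum_span l)%R.
Proof.
induction 1 as [|t l Ht _ IH]; simpl; [lra|unfold is_triangle in Ht; lra].
Qed.

Lemma sum_span_app (l l' : list tri) :
  sum_span (l ++ l') = (sum_span l + sum_span l')%R.
Proof. induction l as [|t l IH]; simpl; [lra|rewrite IH; lra]. Qed.

(* Two triangles whose deflations contain adjacent points can be replaced by
   their hull at no cost, so one triangle suffices for a connected set. *)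
Lemma single_triangle (E : pset) (x : pt) (n : nat) (l : list tri) :
  conn_by adj E -> E x -> length l = n -> List.Forall is_triangle l ->
  (forall p, E p -> exists t, In t l /\ inL (Defl t 2) p) ->
  exists t, (forall p, E p -> inL (Defl t 2) p) /\ (tri_span t <= sum_span l)%R.
Proof.
intros HE Ex; revert l; induction n as [|n IH]; intros l Hn Hl Hc.
- destruct l; [|discriminate]; destruct (Hc x Ex) as (t & [] & _).
- destruct l as [|t l]; [discriminate|]; injection Hn as Hn.
  pose proof (Forall_inv Hl) as Ht; pose proof (Forall_inv_tail Hl) as Hl'.
  (* If the deflated [t] misses [E], drop [t]; if it contains [E], [t] suffices; otherwise an edge
     of [E] crosses its boundary, and [t] merges with a triangle covering the outer endpoint. *)
  destruct (classic (exists u, E u /\ inL (Defl t 2) u)) as [(u & Eu & Hu)|N].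
  2:{ destruct (IH l Hn Hl') as (t' & H1 & H2).
      - intros p Ep; destruct (Hc p Ep) as (t' & [<-|Hin] & Hp); eauto.
        exfalso; eauto.
      - exists t'; split; auto; simpl; unfold is_triangle in Ht; lra. }
  destruct (classic (exists v, E v /\ ~ inL (Defl t 2) v)) as [(v & Ev & Hv)|N].
  2:{ exists t; split.
      - intros p Ep; apply NNPP; intros nP; apply N; eauto.
      - simpl; pose proof (sum_span_ge0 _ Hl'); lra. }
  destruct (conn_by_cross E (inL (Defl t 2)) u v HE Eu Ev Hu Hv)
    as (u' & v' & Eu' & Ev' & Ha & Hu' & Hv').
  destruct (Hc v' Ev') as (t' & [<-|Hin] & Hp); [tauto|].
  destruct (in_split _ _ Hin) as (l1 & l2 & ->).
  pose proof (hull_span _ _ _ _ Hu' Hp Ha) as Hs.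
  destruct (IH (hull t t' :: l1 ++ l2)) as (t'' & H1 & H2).
  + rewrite length_app in Hn; simpl in *; rewrite length_app; lia.
  + constructor; [apply hull_triangle; auto|].
    apply Forall_app in Hl'; destruct Hl' as [K1 K2].
    apply Forall_app; split; auto; exact (Forall_inv_tail K2).
  + intros p Ep; destruct (Hc p Ep) as (s & Hin' & Hps).
    destruct Hin' as [<-|Hin'].
    { exists (hull t t'); split; [left; auto|apply hull_l; auto]. }
    apply in_app_or in Hin'; destruct Hin' as [Hin'|[<-|Hin']].
    * exists s; split; auto; right; apply in_or_app; auto.
    * exists (hull t t'); split; [left; auto|apply hull_r; auto].
    * exists s; split; auto; right; apply in_or_app; auto.
  + exists t''; split; auto.
    revert H2; simpl; rewrite !sum_span_app; simpl; lra.
Qed.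

Lemma floor_spec (r : R) : exists n : Z, (IZR n <= r < IZR n + 1)%R.
Proof. destruct (archimed r); exists (up r - 1)%Z; rewrite minus_IZR; lra. Qed.

Lemma floor_le (r : R) (n z : Z) :
  (r < IZR n + 1)%R -> (IZR z <= r)%R -> (z <= n)%Z.
Proof.
intros H1 H2; apply Zlt_succ_le, lt_IZR; unfold Z.succ; rewrite plus_IZR; lra.
Qed.

Lemma inT_sum_ge0 (a b c : Z) (p : pt) : inT a b c p -> (0 <= a + b + c)%Z.
Proof. unfold inT; lia. Qed.

Lemma Span_ge0 (E : pset) : Rbar_le 0 (Span E).
Proof.
apply (proj2 (Glb_Rbar_correct (cover_costs E 2))).
intros s (l & _ & Hl & _ & ->); simpl; apply sum_span_ge0; auto.
Qed.

Lemma Span_empty (E : pset) : (forall p, ~ E p) -> Rbar_le (Span E) 0.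
Proof.
intros H; apply (proj1 (Glb_Rbar_correct (cover_costs E 2)) 0%R).
exists nil; repeat split; try constructor.
intros p Ep; exfalso; exact (H p Ep).
Qed.

(** A cover reduces to one triangle, whose deflated sides can be rounded down because the points are
    integral. *)
Lemma lt_Span (E : pset) (x0 : pt) (x : R) : connected E -> E x0 ->
  Rbar_lt x (Span E) <-> big E x.
Proof.
rewrite connected_conn_by; intros HE Ex0.
destruct (Glb_Rbar_correct (cover_costs E 2)) as [Hlb Hglb].
fold (span_set E 2) in Hlb, Hglb; fold (Span E) in Hlb, Hglb.
split.
- intros H a b c Habc.
  pose proof (IZR_le _ _ (inT_sum_ge0 _ _ _ _ (Habc x0 Ex0))) as Hge.
  assert (Hle : Rbar_le (Span E) (IZR (a + b + c) + 6)%R).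
  { apply Hlb; rewrite !plus_IZR in *.
    exists ((IZR a + 2, IZR b + 2, IZR c + 2)%R :: nil).
    split; [|split; [|split]].
    - constructor; [simpl; tauto|constructor].
    - constructor; [unfold is_triangle, tri_span; lra|constructor].
    - intros p Ep; exists (IZR a + 2, IZR b + 2, IZR c + 2)%R.
      split; [left; auto|]; destruct (Habc p Ep) as (H1 & H2 & H3).
      apply IZR_le in H1, H2, H3; rewrite ?opp_IZR, ?plus_IZR in *.
      unfold inL, Defl; lra.
    - unfold sum_span, tri_span; simpl; lra. }
  exact (Rbar_lt_le_trans _ _ _ H Hle).
- intros H; apply Rbar_not_le_lt; intros Hle.
  (* The infimum is not shown to be attained. Some cost lies below [n + 1], so the integral span
     plus 6 is at most [n], hence at most [x]. *)
  destruct (floor_spec x) as (n & Hn1 & Hn2).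
  assert (Hs : exists s, cover_costs E 2 s /\ (s < IZR n + 1)%R).
  { apply NNPP; intros N.
    assert (K : Rbar_le (IZR n + 1)%R (Span E)).
    { apply Hglb; intros s Hs; simpl; apply Rnot_lt_le; intros Hlt; eauto. }
    pose proof (Rbar_le_trans _ _ _ K Hle) as K'; simpl in K'; lra. }
  destruct Hs as (s & (l & _ & Hl & Hc & ->) & Hs).
  destruct (single_triangle E x0 _ l HE Ex0 eq_refl Hl Hc) as ([[a b] c] & Ht & Hspan).
  unfold tri_span in Hspan.
  destruct (floor_spec (a - 2)) as (a' & Ha1 & Ha2).
  destruct (floor_spec (b - 2)) as (b' & Hb1 & Hb2).
  destruct (floor_spec (c - 2)) as (c' & Hc1 & Hc2).
  assert (Hbig : (x < IZR (a' + b' + c') + 6)%R).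
  { apply H; intros p Ep; destruct (Ht p Ep) as (H1 & H2 & H3).
    rewrite <- !opp_IZR in *; rewrite <- plus_IZR in H3.
    split; [|split]; eapply floor_le; eassumption. }
  assert (Hint : (a' + b' + c' + 6 <= n)%Z).
  { apply (floor_le (sum_span l)); auto; rewrite !plus_IZR; lra. }
  apply IZR_le in Hint; rewrite plus_IZR in Hint; lra.
Qed.

(** * Removing a piece, joining triangles, splitting lists *)

(** A walk in [T] that enters [D] can leave it only into [F], and all of [F] is reached from [c]
    outside [D], so the detour can be skipped. *)
Lemma conn_by_diff (e : pt -> pt -> Prop) (T D F : pset) (c : pt) :
  (forall u v, e u v -> u = v \/ adj u v) -> conn_by e T -> conn_by adj F -> F c ->
  (forall p, F p -> T p /\ ~ D p) ->
  (forall u v, D u -> T v -> e u v -> D v \/ F v) ->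
  conn_by adj (fun p => T p /\ ~ D p).
Proof.
intros He HT HF Fc HFT HD.
assert (FR : forall z, F z -> reach (fun p => T p /\ ~ D p) c z).
{ intros z Fz; apply (HF _ c z); auto; [constructor|].
  intros u v _ Fv Ha Hu; exact (reach_step _ _ _ _ Hu (HFT v Fv) Ha). }
apply (conn_by_of_reach _ c); [auto|].
intros z [Tz nDz].
enough (K : reach (fun p => T p /\ ~ D p) c z \/ D z) by tauto.
apply (HT (fun p => reach (fun p => T p /\ ~ D p) c p \/ D p) c z); auto.
{ exact (proj1 (HFT c Fc)). }
intros u v Tu Tv Huv [Ru|Du].
- destruct (classic (D v)) as [Dv|nDv]; [auto|left].
  destruct (He u v Huv) as [<-|Ha]; [auto|].
  exact (reach_step _ _ _ _ Ru (conj Tv nDv) Ha).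
- destruct (HD u v Du Tv Huv); auto.
Qed.

Lemma big_mono (E F : pset) (x y : R) :
  (forall p, E p -> F p) -> (y <= x)%R -> big E x -> big F y.
Proof. intros H Hxy HE a b c K; specialize (HE a b c ltac:(auto)); lra. Qed.

Lemma not_big (E : pset) (x : R) : ~ big E x ->
  exists a b c, (forall p, E p -> inT a b c p) /\ (IZR (a + b + c) + 6 <= x)%R.
Proof.
intros H; apply NNPP; intros N; apply H; intros a b c K.
apply Rnot_le_lt; intros Hle; apply N; exists a, b, c; auto.
Qed.

(** The hull saves [min a a' + min b b' + min c c'], which adjacent points keep at least -1. *)
Lemma inT_join (a b c a' b' c' : Z) (u v : pt) :
  inT a b c u -> inT a' b' c' v -> adj u v ->
  (Z.max a a' + Z.max b b' + Z.max c c' <= a + b + c + (a' + b' + c') + 1)%Z.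
Proof. destruct u, v; rewrite adjE; unfold inT, fst, snd; lia. Qed.

Lemma inT_max_l (a b c a' b' c' : Z) (p : pt) :
  inT a b c p -> inT (Z.max a a') (Z.max b b') (Z.max c c') p.
Proof. unfold inT; lia. Qed.

Lemma inT_max_r (a b c a' b' c' : Z) (p : pt) :
  inT a' b' c' p -> inT (Z.max a a') (Z.max b b') (Z.max c c') p.
Proof. unfold inT; lia. Qed.

(** A point of a tile exceeds the corner by at most 1 in each coordinate and never has a smaller
    coordinate sum. The span grows by 2, whence the shift from [beta] to [beta + 2]. *)
Lemma inT_Q (a b c : Z) (p v : pt) :
  In v (Q p) -> inT a b c v -> inT (a + 1) (b + 1) c p.
Proof. destruct p, v; rewrite in_QE; unfold inT, fst, snd; lia. Qed.

Definition mem (l : list pt) : pset := fun p => In p l.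

Definition keep (K : pset) (p : pt) : bool :=
  if excluded_middle_informative (K p) then true else false.

Lemma keepP (K : pset) (p : pt) : keep K p = true <-> K p.
Proof. unfold keep; destruct (excluded_middle_informative (K p)); split; auto; discriminate. Qed.

Lemma in_filter_keep (K : pset) (l : list pt) (p : pt) :
  In p (filter (keep K) l) <-> In p l /\ K p.
Proof. rewrite filter_In, keepP; tauto. Qed.

Lemma length_filter_keep (K : pset) (l : list pt) :
  length l = (length (filter (keep K) l) + length (filter (keep (fun p => ~ K p)) l))%nat.
Proof.
induction l as [|p l IH]; simpl; [reflexivity|].
pose proof (keepP K p) as H; pose proof (keepP (fun p => ~ K p) p) as H'.
destruct (keep K p), (keep (fun p => ~ K p) p); simpl; try lia; exfalso.
- tauto.
- destruct (classic (K p)) as [Kp|nKp]; [apply H in Kp|apply H' in nKp]; discriminate.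
Qed.

Lemma length_pos (p : pt) (l : list pt) : In p l -> (0 < length l)%nat.
Proof. destruct l; [intros []|simpl; lia]. Qed.

(** * Cuts of R(S) by tiles and the effect of minimality *)

(* A cut of R(S) whose two sides together with the cut set exhaust R(S), and
   whose sides are only required not to be linked through points of S. *)
Definition tile_cut (S A1 A2 : pset) (l : list pt) (x : R) : Prop :=
  NoDup l /\ (forall p, Rtoom S p <-> A1 p \/ mem l p \/ A2 p) /\
  (forall p, A1 p -> ~ mem l p) /\ (forall p, A2 p -> ~ mem l p) /\
  (forall p q, A1 p -> A2 q -> ~ sadj S p q) /\
  (conn_by adj (setU A1 (mem l)) /\ big (setU A1 (mem l)) x) /\
  (conn_by adj (setU A2 (mem l)) /\ big (setU A2 (mem l)) x).

Lemma tile_cut_sym (S A1 A2 : pset) (l : list pt) (x : R) :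
  tile_cut S A1 A2 l x -> tile_cut S A2 A1 l x.
Proof.
intros (H1 & H2 & H3 & H4 & H5 & H6 & H7); repeat (split; auto).
- intros Tp; apply H2 in Tp; tauto.
- intros K; apply H2; tauto.
- intros p q Ap Aq K; exact (H5 q p Aq Ap (sadj_sym _ _ _ K)).
Qed.

(** A link with an end in [A] has its common point in the shadow of [A]; links between two cut tiles
    are left out, as their common point may be lost in the passage to [S]. *)
Definition touch (S A : pset) (u v : pt) : Prop := sadj S u v /\ (A u \/ A v).

Section Split.
Variables (S A1 A2 : pset) (l : list pt) (alpha beta : R).
Let B : pset := setU A1 (mem l).
Let bound (n : nat) : R := (alpha * INR n + beta + 2)%R.
Hypothesis alpha_ge0 : (0 <= alpha)%R.
Hypothesis beta_le3 : (beta <= 3)%R.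
Hypothesis conn_T : conn_by adj (Rtoom S).
Hypothesis cut : tile_cut S A1 A2 l (bound (length l)).
Hypothesis minimal : forall A1' A2' l', (0 < length l' < length l)%nat ->
  ~ tile_cut S A1' A2' l' (bound (length l')).

Definition touch_closed (K : pset) : Prop :=
  (forall p, K p -> B p) /\ (forall u v, K u -> B v -> touch S A1 u v -> K v).

Lemma touch_closed_compl (K : pset) :
  touch_closed K -> touch_closed (fun p => B p /\ ~ K p).
Proof.
intros [H1 H2]; split; [tauto|].
intros u v [Bu nKu] Bv [Huv HA]; split; [auto|intros Kv].
apply nKu, (H2 v u); auto; split; [apply sadj_sym; auto|tauto].
Qed.

Lemma side_closed (u v : pt) : A1 u -> Rtoom S v -> sadj S u v -> B v.
Proof.
destruct cut as (_ & H2 & _ & _ & H5 & _); intros Au Tv Huv.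
apply H2 in Tv; unfold B, setU; destruct Tv as [K|[K|K]]; auto.
exfalso; exact (H5 u v Au K Huv).
Qed.

Lemma B_T (p : pt) : B p -> Rtoom S p.
Proof. destruct cut as (_ & H2 & _); intros [K|K]; apply H2; auto. Qed.

(** If [K] missed [l], it would lie in [A1], where every link in R(S) is a touching step inside [B];
    connectedness of R(S) would then put [x] into [K]. *)
Lemma touch_closed_meets (K : pset) (x y : pt) :
  touch_closed K -> K y -> B x -> ~ K x -> exists p, mem l p /\ K p.
Proof.
intros [HK1 HK2] Ky Bx nKx; apply NNPP; intros N; apply nKx.
assert (KA : forall p, K p -> A1 p).
{ intros p Kp; destruct (HK1 p Kp) as [A|M]; [auto|exfalso; eauto]. }
apply (conn_by_sadj S conn_T K y x); auto; [apply B_T; auto|apply B_T; auto|].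
intros u v _ Tv Huv Ku; apply (HK2 u v); auto.
- exact (side_closed u v (KA u Ku) Tv Huv).
- split; auto.
Qed.

(** Were [K] big, its part in [A1] and the rest of R(S) would form a tile cut along the elements of
    [l] in [K]. This list is nonempty because of [c] and shorter than [l] because of [d], against
    minimality. *)
Lemma part_small (K : pset) (c d : pt) : touch_closed K -> conn_by adj K ->
  mem l c -> K c -> mem l d -> ~ K d ->
  exists a b c, (forall p, K p -> inT a b c p) /\
    (IZR (a + b + c) + 6 <= bound (length (filter (keep K) l)))%R.
Proof.
intros [HK1 HK2] HK lc Kc ld nKd; apply not_big; intros Hbig.
set (l' := filter (keep K) l) in *.
assert (Hl' : (0 < length l' < length l)%nat).
{ rewrite (length_filter_keep K l); fold l'.
  assert (Hc : In c l') by (apply in_filter_keep; auto).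
  assert (Hd : In d (filter (keep (fun p => ~ K p)) l)) by (apply in_filter_keep; auto).
  apply length_pos in Hc, Hd; lia. }
pose proof cut as (H1 & H2 & H3 & H4 & H5 & (H6 & H6') & (H7 & H7')).
set (D := fun p => A1 p /\ K p).
apply (minimal D (fun p => A2 p \/ (B p /\ ~ K p)) l' Hl').
(* A tile of R(S) is linked to itself, so unlinked sides are disjoint. *)
assert (A21 : forall p, A2 p -> ~ A1 p).
{ intros p Ap Ap'; apply (H5 p p Ap' Ap).
  destruct (Rtoom_point S p) as (v & Hv & Sv); [apply H2; auto|exists v; auto]. }
assert (rest : forall p, (Rtoom S p /\ ~ D p) <->
  setU (fun p => A2 p \/ (B p /\ ~ K p)) (mem l') p).
{ intros p; unfold setU, D, mem, l'; rewrite in_filter_keep; fold (mem l p).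
  specialize (H2 p); specialize (A21 p); specialize (H3 p); unfold B, setU.
  destruct (classic (K p)); tauto. }
split; [apply NoDup_filter; auto|].
split; [|split; [|split; [|split; [|split; [split|split]]]]].
- intros p; specialize (rest p); unfold setU in rest.
  pose proof (H2 p); unfold D in *; split; intros HH; [|tauto].
  destruct (classic (A1 p /\ K p)); tauto.
- intros p [Ap _] Hp; apply in_filter_keep in Hp; exact (H3 p Ap (proj1 Hp)).
- intros p Ap Hp; apply in_filter_keep in Hp; destruct Ap as [Ap|[_ nKp]].
  + exact (H4 p Ap (proj1 Hp)).
  + exact (nKp (proj2 Hp)).
- intros p q [Ap Kp] [Aq|[Bq nKq]] Hpq; [exact (H5 p q Ap Aq Hpq)|].
  apply nKq, (HK2 p q); auto; split; auto.
- apply (conn_by_ext adj K); [|auto].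
  intros p; unfold setU, mem, l', D; rewrite in_filter_keep; fold (mem l p).
  specialize (HK1 p); unfold B, setU in HK1; tauto.
- apply (big_mono K _ (bound (length l'))); [|lra|auto].
  intros p; unfold setU, mem, l', D; rewrite in_filter_keep; fold (mem l p).
  specialize (HK1 p); unfold B, setU in HK1; tauto.
- apply (conn_by_ext adj _ _ rest).
  (* Links that leave [D] end in [l], so the rest of R(S) stays connected around [A2] and [l]. *)
  apply (conn_by_diff (sadj S) _ _ (setU A2 (mem l)) c).
  + exact (sadj_adj S).
  + exact (conn_by_sadj S conn_T).
  + exact H7.
  + right; auto.
  + intros p Hp; split; [apply H2; unfold setU in Hp; tauto|].
    intros [Ap _]; destruct Hp as [Hp|Hp]; [exact (A21 p Hp Ap)|exact (H3 p Ap Hp)].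
  + intros u v [Au Ku] Tv Huv; pose proof (side_closed u v Au Tv Huv) as Bv.
    destruct Bv as [Av|Mv]; [left|right; right; auto].
    split; auto; apply (HK2 u v); [auto|left; auto|split; auto].
- apply (big_mono (setU A2 (mem l)) _ (bound (length l))); [| |auto].
  + intros p Hp; apply rest; split; [apply H2; unfold setU in Hp; tauto|].
    intros [Ap _]; destruct Hp as [Hp|Hp]; [exact (A21 p Hp Ap)|exact (H3 p Ap Hp)].
  + unfold bound; pose proof (le_INR (length l') (length l) ltac:(lia)); nra.
Qed.

(* A piece closed under [touch] and the rest of A1 + l both yield smaller cuts
   if they are connected, so by minimality both are small; joining their
   triangles contradicts the size of A1 + l because beta <= 3. *)
Lemma minimal_touch_conn : conn_by (touch S A1) B.
Proof.
intros P x y Bx By Px HP; apply NNPP; intros nPy.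
pose proof cut as (H1 & H2 & H3 & H4 & H5 & (H6 & H6') & _).
(* The [touch] component of [x], as the intersection of the closed sets containing [x]. *)
set (H := fun z => B z /\ forall P : pset, P x ->
  (forall u v, B u -> B v -> touch S A1 u v -> P u -> P v) -> P z).
assert (Hx : H x) by (split; auto).
assert (HH : touch_closed H).
{ split; [intros p [Bp _]; auto|].
  intros u v [Bu Hu] Bv Huv; split; [auto|].
  intros P' Px' HP'; exact (HP' u v Bu Bv Huv (Hu P' Px' HP')). }
assert (nHy : ~ H y) by (intros [_ Hy]; apply nPy, Hy; auto).
assert (cH : conn_by adj H).
{ apply (conn_by_of_reach _ x Hx); intros z [Bz Hz].
  apply (Hz (fun z => H z /\ reach H x z)); [split; [auto|constructor]|].
  intros u v Bu Bv Huv [Hu Ru].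
  assert (Hv : H v) by (apply (proj2 HH u v); auto).
  split; auto; destruct (sadj_adj _ _ _ (proj1 Huv)) as [<-|Ha]; auto.
  exact (reach_step _ _ _ _ Ru Hv Ha). }
(* A component, for plain adjacency, of [B] without [H]. All of [B] without [H] might be
   disconnected, whereas both [K] and its complement in [B] are connected: every step out of [K]
   leads into [H]. *)
set (K := fun z => (B z /\ ~ H z) /\ reach (fun z => B z /\ ~ H z) y z).
assert (Ky : K y) by (split; [auto|constructor]).
assert (cK : conn_by adj K).
{ apply (conn_by_of_reach _ y Ky); intros z [_ Rz]; clear -Rz By nHy.
  assert (Q' : K z /\ reach K y z); [|tauto].
  induction Rz as [|u v Ru [Ku IH] Ev Ha].
  - split; [split; [auto|constructor]|constructor].
  - assert (Kv : K v) by (split; [auto|exact (reach_step _ _ _ _ Ru Ev Ha)]).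
    split; [auto|exact (reach_step _ _ _ _ IH Kv Ha)]. }
assert (stepK : forall u v, K u -> B v -> adj u v -> K v \/ H v).
{ intros u v [_ Ru] Bv Ha; destruct (classic (H v)) as [Hv|nHv]; [auto|left].
  split; [auto|exact (reach_step _ _ _ _ Ru (conj Bv nHv) Ha)]. }
assert (tK : touch_closed K).
{ split; [intros p [[Bp _] _]; auto|].
  intros u v Ku Bv Huv.
  destruct (sadj_adj _ _ _ (proj1 Huv)) as [<-|Ha]; auto.
  destruct (stepK u v Ku Bv Ha) as [|Hv]; auto; exfalso.
  destruct (touch_closed_compl H HH) as [_ Hc].
  apply (Hc u v); auto; apply Ku. }
assert (nKx : ~ K x) by (intros [[_ N] _]; auto).
set (K' := fun z => B z /\ ~ K z).
assert (tK' : touch_closed K') by (apply touch_closed_compl; auto).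
assert (cK' : conn_by adj K').
{ apply (conn_by_diff adj B K H x); auto.
  intros p Hp; split; [exact (proj1 Hp)|intros [[_ N] _]; exact (N Hp)]. }
destruct (touch_closed_meets K x y tK Ky Bx nKx) as (c & lc & Kc).
destruct (touch_closed_meets K' y x tK') as (d & ld & Kd'); auto;
  [split; auto|intros [_ N]; auto|].
destruct (part_small K c d tK cK lc Kc ld (proj2 Kd')) as (a1 & b1 & c1 & T1 & S1).
destruct (part_small K' d c tK' cK' ld Kd' lc) as (a2 & b2 & c2 & T2 & S2);
  [intros [_ N]; auto|].
destruct (conn_by_cross B K y x H6 By Bx Ky nKx) as (u & v & Bu & Bv & Ha & Ku & nKv).
pose proof (inT_join _ _ _ _ _ _ _ _ (T1 u Ku) (T2 v (conj Bv nKv)) Ha) as Hj.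
assert (Hb : (bound (length l) < IZR (Z.max a1 a2 + Z.max b1 b2 + Z.max c1 c2) + 6)%R).
{ apply H6'; intros p Bp; destruct (classic (K p)) as [Kp|nKp].
  - apply inT_max_l; auto.
  - apply inT_max_r, T2; split; auto. }
apply IZR_le in Hj; rewrite !plus_IZR in *.
assert (Hlen : length l = (length (filter (keep K) l) + length (filter (keep K') l))%nat).
{ rewrite (length_filter_keep K l) at 1; f_equal; f_equal.
  apply filter_ext_in; intros p lp; apply Bool.eq_true_iff_eq; rewrite !keepP.
  unfold K'; split; [|tauto]; intros N; split; auto; right; exact lp. }
(* With [s1], [s2] the spans of the two triangles, [bound (length l) < s1 + s2 + 7], while [s1 + 6]
   and [s2 + 6] are at most the bounds for the two parts of [l]. As the lengths add up, [beta > 3]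
   would follow. *)
unfold bound in *; rewrite Hlen, plus_INR in Hb; lra.
Qed.

(* For a cut tile p without such a neighbour, A1 + l would be {p}, which has
   span 6. *)
Lemma minimal_touches (p : pt) : (6 <= alpha + beta)%R -> mem l p ->
  exists q, A1 q /\ sadj S p q.
Proof.
intros Hab lp; apply NNPP; intros N.
pose proof cut as (_ & _ & H3 & _ & _ & (_ & H6') & _).
assert (Bp : forall q, B q -> q = p).
{ intros q Bq; apply (minimal_touch_conn (fun q => q = p) p q); auto.
  - right; auto.
  - intros u v _ _ [Huv [Au|Av]] ->; exfalso.
    + exact (H3 p Au lp).
    + eauto. }
specialize (H6' (- fst p) (- snd p) (fst p + snd p))%Z.
replace (- fst p + - snd p + (fst p + snd p))%Z with 0%Z in H6' by lia.
pose proof (length_pos _ _ lp : (1 <= length l)%nat) as L.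
apply le_INR in L; simpl in L.
assert (F : (bound (length l) < 0 + 6)%R).
{ apply H6'; intros q Bq; rewrite (Bp q Bq); unfold inT; lia. }
unfold bound in F; nra.
Qed.

End Split.

(** * Passing from tiles to points of [S] *)

Definition shadow (S A : pset) : pset := fun v => S v /\ exists q, A q /\ In v (Q q).

(** A tile has three points, so [P] sets one of them against the other two, and every pair separated
    by [P] contains that one. It is [u0] or [w0], which later places it in [S]. *)
Lemma Q_minority (P : pset) (p u0 w0 : pt) :
  In u0 (Q p) -> In w0 (Q p) -> P u0 -> ~ P w0 ->
  exists v, (v = u0 \/ v = w0) /\
    forall u w, In u (Q p) -> In w (Q p) -> P u -> ~ P w -> u = v \/ w = v.
Proof.
intros Hu0 Hw0 Pu0 nPw0.
destruct (classic (exists u1, In u1 (Q p) /\ P u1 /\ u1 <> u0)) as [(u1 & Hu1 & Pu1 & ne)|N].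
- exists w0; split; auto; intros u w _ Hw _ nPw; right.
  assert (w <> u0) by congruence; assert (w <> u1) by congruence.
  assert (w0 <> u0) by congruence; assert (w0 <> u1) by congruence.
  unfold Q in *; simpl in *; intuition congruence.
- exists u0; split; auto; intros u w Hu _ Pu _; left.
  apply NNPP; intros ne; apply N; exists u; auto.
Qed.

Section Transfer.
Variables (S A : pset) (l : list pt) (c : pt -> pt).
Hypothesis in_T : forall q, setU A (mem l) q -> Rtoom S q.
Hypothesis c_in : forall p, mem l p -> In (c p) (Q p) /\ S (c p).
Let Y : pset := setU (shadow S A) (mem (map c l)).

Lemma transfer_meets (q : pt) : setU A (mem l) q -> exists v, In v (Q q) /\ Y v.
Proof.
intros [Aq|lq].
- destruct (Rtoom_point S q) as (v & Hv & Sv); [apply in_T; left; auto|].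
  exists v; split; [auto|left; split; eauto].
- exists (c q); split; [apply c_in; auto|right; apply in_map; auto].
Qed.

Lemma transfer_tile (v : pt) : Y v -> exists q, setU A (mem l) q /\ In v (Q q).
Proof.
intros [(_ & q & Aq & Hv)|Hv].
- exists q; split; [left|]; auto.
- apply in_map_iff in Hv; destruct Hv as (q & <- & lq).
  exists q; split; [right; auto|apply c_in; auto].
Qed.

(* Connectedness along the touching relation lifts to points because touching
   tiles meet in a point of the shadow of A and every tile is a clique. *)
Lemma transfer_conn : conn_by (touch S A) (setU A (mem l)) -> conn_by adj Y.
Proof.
intros HA P x y Yx Yy Px HP.
assert (spread : forall q v, In v (Q q) -> Y v -> P v ->
  forall w, In w (Q q) -> Y w -> P w).
{ intros q v Hv Yv Pv w Hw Yw.
  destruct (Q_clique q v w Hv Hw) as [<-|Ha]; auto; apply (HP v w); auto. }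
destruct (transfer_tile x Yx) as (q & Bq & Hx).
destruct (transfer_tile y Yy) as (q' & Bq' & Hy).
enough (K : forall v, In v (Q q') -> Y v -> P v) by auto.
apply (HA (fun q => forall v, In v (Q q) -> Y v -> P v) q q'); auto.
- exact (spread q x Hx Yx Px).
- intros r r' _ _ [(v & Sv & Hv & Hv') HA'] Hr.
  assert (Yv : Y v) by (left; split; [auto|destruct HA'; eauto]).
  exact (spread r' v Hv' Yv (Hr v Hv Yv)).
Qed.

Lemma transfer_big (x : R) : big (setU A (mem l)) (x + 2) -> big Y x.
Proof.
intros HA a b d K.
assert (F : (x + 2 < IZR (a + 1 + (b + 1) + d) + 6)%R).
{ apply HA; intros q Bq; destruct (transfer_meets q Bq) as (v & Hv & Yv).
  exact (inT_Q _ _ _ _ _ Hv (K v Yv)). }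
rewrite !plus_IZR in *; lra.
Qed.

End Transfer.

(** * Building connected cuts of [S] *)

Lemma Rbar_lt_min (x a b : Rbar) : Rbar_lt x a -> Rbar_lt x b -> Rbar_lt x (Rbar_min a b).
Proof. intros; apply Rbar_min_case; auto. Qed.

Lemma Rbar_lt_min_inv (x a b : Rbar) :
  Rbar_lt x (Rbar_min a b) -> Rbar_lt x a /\ Rbar_lt x b.
Proof.
intros H; split; eapply Rbar_lt_le_trans; [exact H|apply Rbar_min_l|exact H|apply Rbar_min_r].
Qed.

(** The set [P] is an invariant of paths avoiding [C], so no such path leads from [A1] to [A2]. *)
Lemma cut_of_closed (S C A1 A2 P : pset) :
  (forall x, C x -> S x) -> (forall x, A1 x -> S x) -> (forall x, A2 x -> S x) ->
  (forall x, A1 x -> ~ C x) -> (forall x, A2 x -> ~ C x) ->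
  (forall x, A1 x -> P x) -> (forall x, A2 x -> ~ P x) ->
  (forall u v, P u -> S u -> S v -> ~ C u -> ~ C v -> adj u v -> P v) ->
  is_cut S C A1 A2.
Proof.
intros HC H1 H2 H1C H2C H1P H2P HP.
repeat split; auto.
- intros x [Cx Ax]; exact (H1C x Ax Cx).
- intros x [Cx Ax]; exact (H2C x Ax Cx).
- intros x [Ax Ax']; exact (H2P x Ax' (H1P x Ax)).
- intros x l [Hc Hl] Ax Al; apply NNPP; intros N.
  apply (H2P _ Al), (path_closed (fun u => S u /\ ~ C u) P x l); auto.
  + intros u v [Su Cu] [Sv Cv] Ha Pu; apply (HP u v); auto.
  + split; auto; apply Forall_forall; intros z Hz; split.
    * rewrite Forall_forall in Hl; auto.
    * intros Cz; apply N, Exists_exists; eauto.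
Qed.

Lemma good_k_of_big (S C A1 A2 : pset) (k : nat) (alpha beta : R) (x1 x2 : pt) :
  is_cut S C A1 A2 -> card_is C k -> setU A1 C x1 -> setU A2 C x2 ->
  conn_by adj (setU A1 C) -> conn_by adj (setU A2 C) ->
  big (setU A1 C) (alpha * INR k + beta) -> big (setU A2 C) (alpha * INR k + beta) ->
  good_k S alpha beta k.
Proof.
rewrite <- !connected_conn_by; intros HC Hk H1 H2 C1 C2 B1 B2.
eexists; split; [exists C, A1, A2; repeat split; eauto; apply HC|].
apply Rbar_lt_min; [apply (lt_Span _ x1)|apply (lt_Span _ x2)]; auto.
Qed.

Lemma good_k_of_tile_cut (S A1 A2 : pset) (l : list pt) (alpha beta : R) :
  (0 <= alpha)%R -> (0 < length l)%nat ->
  tile_cut S A1 A2 l (alpha * INR (length l) + beta + 2) ->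
  conn_by (touch S A1) (setU A1 (mem l)) -> conn_by (touch S A2) (setU A2 (mem l)) ->
  (forall p, mem l p -> exists q, A1 q /\ sadj S p q) ->
  (forall p, mem l p -> exists q, A2 q /\ sadj S p q) ->
  exists k, (k <= length l)%nat /\ good_k S alpha beta k.
Proof.
intros Ha Hl (H1 & H2 & H3 & H4 & H5 & [_ H6] & [_ H7]) T1 T2 M1 M2.
assert (U12 : forall v, shadow S A2 v -> ~ shadow S A1 v).
{ intros v (Sv & q & Aq & Hq) (_ & p & Ap & Hp); apply (H5 p q Ap Aq).
  exists v; auto. }
assert (Hc : exists c, forall p, mem l p -> (In (c p) (Q p) /\ S (c p)) /\
  forall u w, In u (Q p) -> In w (Q p) -> shadow S A1 u -> ~ shadow S A1 w ->
  u = c p \/ w = c p).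
{ exists (fun p => epsilon (inhabits p) (fun v => (In v (Q p) /\ S v) /\
    forall u w, In u (Q p) -> In w (Q p) -> shadow S A1 u -> ~ shadow S A1 w ->
    u = v \/ w = v)).
  intros p lp; apply (epsilon_spec (inhabits p)
    (fun v => (In v (Q p) /\ S v) /\
    forall u w, In u (Q p) -> In w (Q p) -> shadow S A1 u -> ~ shadow S A1 w ->
    u = v \/ w = v)).
  destruct (M1 p lp) as (q1 & Aq1 & u0 & Su & Hu & Hu').
  destruct (M2 p lp) as (q2 & Aq2 & w0 & Sw & Hw & Hw').
  destruct (Q_minority (shadow S A1) p u0 w0) as (v & Hv & K); auto.
  - split; eauto.
  - apply U12; split; eauto.
  - exists v; split; auto; destruct Hv as [-> | ->]; auto. }
destruct Hc as (c & Hc).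
set (C := mem (map c l)).
assert (dec : forall u v : pt, {u = v} + {u <> v}) by (decide equality; apply Z.eq_dec).
(* Different tiles may share their chosen point, so [k] can be less than [length l]. *)
set (k := length (nodup dec (map c l))).
assert (Hk : (k <= length l)%nat).
{ rewrite <- (length_map c l); apply NoDup_incl_length; [apply NoDup_nodup|].
  intros v; apply nodup_In. }
assert (in1 : forall q, setU A1 (mem l) q -> Rtoom S q)
  by (intros q [K|K]; apply H2; auto).
assert (in2 : forall q, setU A2 (mem l) q -> Rtoom S q)
  by (intros q [K|K]; apply H2; auto).
assert (c_in : forall p, mem l p -> In (c p) (Q p) /\ S (c p)) by (intros p lp; apply Hc; auto).
(* Chosen points may lie in a shadow; taking them out makes the sets disjoint and does not change
   the union with [C]. *)
assert (ext : forall A v, setU (shadow S A) C v <->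
  setU (fun v => shadow S A v /\ ~ C v) C v).
{ intros A v; unfold setU; destruct (classic (C v)); tauto. }
assert (le : (alpha * INR k + beta <= alpha * INR (length l) + beta)%R)
  by (apply le_INR in Hk; nra).
exists k; split; [auto|].
destruct l as [|p0 l']; [simpl in Hl; lia|].
assert (C0 : C (c p0)) by (left; auto).
apply (good_k_of_big S C (fun v => shadow S A1 v /\ ~ C v) (fun v => shadow S A2 v /\ ~ C v)
  k alpha beta (c p0) (c p0)); try (right; exact C0).
- apply cut_of_closed with (P := shadow S A1); try tauto.
  + intros v Cv; apply in_map_iff in Cv; destruct Cv as (p & <- & lp); apply c_in; auto.
  + intros v [[Sv _] _]; auto.
  + intros v [[Sv _] _]; auto.
  + intros v [Hv _]; auto.
  (* An edge of [S] leaving the shadow of [A1] lies in a tile [p] of R(S). For [p] in [A1], [w] is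
     in that shadow; for [p] in [l], the minority point is [u] or [w]; for [p] in [A2], [u] is in
     both shadows. *)
  + intros u w Uu Su Sw nCu nCw Haw; apply NNPP; intros nUw.
    destruct (adj_tile u w Haw) as (p & Hu & Hw).
    assert (ne : u <> w) by (intros <-; auto).
    pose proof (Rtoom_of_two S p u w Su Sw ne Hu Hw) as Tp.
    apply H2 in Tp; destruct Tp as [Ap|[lp|Ap]].
    * apply nUw; split; eauto.
    * destruct (proj2 (Hc p lp) u w Hu Hw Uu nUw) as [-> | ->];
        [apply nCu|apply nCw]; apply in_map; auto.
    * apply (U12 u); auto; split; eauto.
- exists (nodup dec (map c (p0 :: l'))); split; [apply NoDup_nodup|split; [auto|]].
  intros v; rewrite nodup_In; reflexivity.
- apply (conn_by_ext adj _ _ (ext A1)), transfer_conn; auto.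
- apply (conn_by_ext adj _ _ (ext A2)), transfer_conn; auto.
- apply (big_mono (setU (shadow S A1) C) _ _ _ (fun v => proj1 (ext A1 v)) le).
  apply transfer_big; auto.
- apply (big_mono (setU (shadow S A2) C) _ _ _ (fun v => proj1 (ext A2 v)) le).
  apply transfer_big; auto.
Qed.

(** * Saturating a given cut of R(S) *)

Lemma reach_in (E : pset) (x y : pt) : E x -> reach E x y -> E y.
Proof. intros Ex [|u v _ Ev _]; auto. Qed.

(** The first side becomes all that is reached from [A1] outside [C], the second all that remains.
    Both only grow, so they stay big; the second is connected since links leaving the first end in
    [C]. Positivity of [k] gives a base point in [C]. *)
Lemma tile_cut_of_good (S : pset) (alpha beta : R) (k : nat) :
  conn_by adj (Rtoom S) -> (0 < k)%nat -> good_k (Rtoom S) alpha (beta + 2) k ->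
  exists A1 A2 l, length l = k /\ tile_cut S A1 A2 l (alpha * INR k + beta + 2).
Proof.
intros conn_T kpos (m & (C & A1 & A2 & HC & (l & Hl & Hk & HCl) & -> & C1 & C2) & Hm).
destruct HC as (CT & A1T & A2T & C_A1 & C_A2 & _ & Hcut).
destruct l as [|c l']; [simpl in Hk; lia|].
assert (Cc : C c) by (apply HCl; left; auto).
rewrite <- Rplus_assoc in Hm.
destruct (Rbar_lt_min_inv _ _ _ Hm) as [B1 B2].
rewrite (lt_Span _ c _ C1 (or_intror Cc)) in B1.
rewrite (lt_Span _ c _ C2 (or_intror Cc)) in B2.
rewrite connected_conn_by in C1, C2.
set (F := fun y => Rtoom S y /\ ~ C y).
set (A1' := fun y => exists x, A1 x /\ reach F x y).
assert (A1F : forall x, A1 x -> F x) by (intros x Ax; split; [auto|intros Cx; exact (C_A1 x (conj Cx Ax))]).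
assert (A1'F : forall x, A1' x -> F x) by (intros x (z & Az & Rz); exact (reach_in F z x (A1F z Az) Rz)).
assert (sub1 : forall p, A1 p -> A1' p) by (intros p Ap; exists p; split; [auto|constructor]).
assert (step1 : forall u v, A1' u -> F v -> sadj S u v -> A1' v).
{ intros u v (x & Ax & Ru) Fv Huv; destruct (sadj_adj _ _ _ Huv) as [<-|Ha];
    exists x; split; auto; exact (reach_step _ _ _ _ Ru Fv Ha). }
set (A2' := fun y => F y /\ ~ A1' y).
assert (sub2 : forall p, A2 p -> A2' p).
{ intros p Ap; split.
  - split; [auto|intros Cp; exact (C_A2 p (conj Cp Ap))].
  - intros (x & Ax & Rx).
    destruct (reach_path F x p (A1F x Ax) Rx) as (q & [Hq Fq] & Hlast).
    assert (K : List.Exists C (x :: q)).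
    { apply Hcut; auto; [|rewrite Hlast; auto].
      split; [auto|]; revert Fq; apply Forall_impl; intros z Fz; apply Fz. }
    apply Exists_exists in K; destruct K as (z & Hz & Cz).
    rewrite Forall_forall in Fq; exact (proj2 (Fq z Hz) Cz). }
exists A1', A2', (c :: l'); split; [auto|].
assert (mC : forall p, mem (c :: l') p <-> C p) by (intros p; symmetry; apply HCl).
split; [auto|split; [|split; [|split; [|split; [|split; [split|split]]]]]].
- intros p; rewrite mC; pose proof (A1'F p); unfold A2', F in *.
  specialize (CT p); split; [|tauto].
  intros Tp; destruct (classic (C p)); [auto|]; destruct (classic (A1' p)); tauto.
- intros p Ap; rewrite mC; apply A1'F; auto.
- intros p Ap; rewrite mC; apply Ap.
- intros p q Ap [Fq nAq] Hpq; exact (nAq (step1 p q Ap Fq Hpq)).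
- apply (conn_by_ext adj (setU A1' C)); [intros p; unfold setU; rewrite mC; tauto|].
  assert (base : forall z, setU A1 C z -> reach (setU A1' C) c z).
  { intros z Ez; apply (C1 (reach (setU A1' C) c) c z); auto; [right; auto|constructor|].
    intros u v _ Ev Ha Hu; apply (reach_step _ _ u); auto.
    destruct Ev; [left|right]; auto. }
  apply (conn_by_of_reach _ c); [right; auto|].
  intros z [(x & Ax & Rz)|Cz]; [|apply base; right; auto].
  assert (Q' : A1' z /\ reach (setU A1' C) c z); [|tauto].
  induction Rz as [|u v Ru [Au IH] Fv Ha].
  + split; [auto|apply base; left; auto].
  + assert (Av : A1' v) by (exists x; split; [auto|exact (reach_step _ _ _ _ Ru Fv Ha)]).
    split; [auto|exact (reach_step _ _ _ _ IH (or_introl Av) Ha)].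
- apply (big_mono (setU A1 C) _ (alpha * INR k + beta + 2)); [|lra|auto].
  intros p; unfold setU; rewrite mC; intuition.
- apply (conn_by_ext adj (fun p => Rtoom S p /\ ~ A1' p)).
  { intros p; unfold setU; rewrite mC; pose proof (A1'F p); specialize (CT p).
    unfold A2', F in *; destruct (classic (C p)); tauto. }
  apply (conn_by_diff (sadj S) _ _ (setU A2 C) c); auto.
  + exact (sadj_adj S).
  + exact (conn_by_sadj S conn_T).
  + right; auto.
  + intros p [Ap|Cp]; split; auto.
    * apply sub2; auto.
    * intros Ap; exact (proj2 (A1'F p Ap) Cp).
  + intros u v Au Tv Huv; destruct (classic (C v)) as [Cv|nCv]; [right; right; auto|left].
    apply (step1 u v); auto; split; auto.
- apply (big_mono (setU A2 C) _ (alpha * INR k + beta + 2)); [|lra|auto].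
  intros p; unfold setU; rewrite mC; intuition.
Qed.

(** * Degenerate cuts and the final comparison *)

Lemma nat_least (P : nat -> Prop) (n : nat) : P n ->
  exists m, (m <= n)%nat /\ P m /\ forall j, (j < m)%nat -> ~ P j.
Proof.
induction n as [n IH] using lt_wf_ind; intros Pn.
destruct (classic (exists j, (j < n)%nat /\ P j)) as [(j & Hj & Pj)|N].
- destruct (IH j Hj Pj) as (m & Hm & K); exists m; split; [lia|auto].
- exists n; repeat split; auto; intros j Hj Pj; apply N; eauto.
Qed.

Lemma conn_by_single (x : pt) (E : pset) : (forall y, E y <-> y = x) -> conn_by adj E.
Proof.
intros HE P y z Ey Ez Py _; apply HE in Ey, Ez; congruence.
Qed.

Lemma big_inhabited (E : pset) (x : R) (p : pt) : E p -> (x < 6)%R -> big E x.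
Proof.
intros Ep Hx a b c K; pose proof (IZR_le _ _ (inT_sum_ge0 _ _ _ _ (K p Ep))); lra.
Qed.

(** An edge of [S] lies in a tile of R(S), and tiles with a common point are equal or adjacent, so
    points in tiles of different components of R(S) are not joined in [S]. *)
Lemma good_0_disconnected (S : pset) (alpha beta : R) :
  (beta <= 3)%R -> ~ conn_by adj (Rtoom S) -> good_k S alpha beta 0.
Proof.
intros Hb N.
assert (D : exists (P : pset) x y, Rtoom S x /\ Rtoom S y /\ P x /\ ~ P y /\
  forall u v, Rtoom S u -> Rtoom S v -> adj u v -> P u -> P v).
{ apply NNPP; intros ND; apply N; intros P x y Tx Ty Px HP; apply NNPP; intros nPy.
  apply ND; exists P, x, y; auto. }
destruct D as (P & x & y & Tx & Ty & Px & nPy & HP).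
destruct (Rtoom_point S x Tx) as (u & Hu & Su).
destruct (Rtoom_point S y Ty) as (w & Hw & Sw).
set (U := fun v => exists q, Rtoom S q /\ P q /\ In v (Q q)).
assert (meet : forall q v, Rtoom S q -> U v -> In v (Q q) -> P q).
{ intros q v Tq (r & Tr & Pr & Hr) Hq.
  destruct (Q_meet r q v Hr Hq) as [<-|Ha]; eauto. }
apply (good_k_of_big S (fun _ => False) (fun v => v = u) (fun v => v = w) 0 alpha beta u w);
  try (left; reflexivity).
- apply cut_of_closed with (P := U); try tauto; try (intros v ->; auto; fail).
  + intros v ->; exists x; auto.
  + intros v -> Uw; exact (nPy (meet y w Ty Uw Hw)).
  + intros a b Ua Sa Sb _ _ Hab; destruct (adj_tile a b Hab) as (q & Ha & Hb').
    destruct (classic (a = b)) as [<-|ne]; [auto|].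
    pose proof (Rtoom_of_two S q a b Sa Sb ne Ha Hb') as Tq.
    exists q; split; [auto|split; [exact (meet q a Tq Ua Ha)|auto]].
- exists nil; split; [constructor|split; [reflexivity|simpl; tauto]].
- apply (conn_by_single u); unfold setU; tauto.
- apply (conn_by_single w); unfold setU; tauto.
- apply (big_inhabited _ _ u); [left; auto|simpl; lra].
- apply (big_inhabited _ _ w); [left; auto|simpl; lra].
Qed.

Lemma good_1_point (S : pset) (alpha beta : R) (x : pt) :
  S x -> (alpha + beta < 6)%R -> good_k S alpha beta 1.
Proof.
intros Sx H.
apply (good_k_of_big S (fun v => v = x) (fun _ => False) (fun _ => False) 1 alpha beta x x);
  try (right; reflexivity).
- apply cut_of_closed with (P := fun _ => False); try tauto; intros v ->; auto.
- exists (x :: nil); split; [constructor; [simpl; tauto|constructor]|split; [reflexivity|]].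
  intros v; simpl; intuition.
- apply (conn_by_single x); unfold setU; tauto.
- apply (conn_by_single x); unfold setU; tauto.
- apply (big_inhabited _ _ x); [right; auto|simpl; lra].
- apply (big_inhabited _ _ x); [right; auto|simpl; lra].
Qed.

Lemma good_0_empty (S : pset) (alpha beta : R) : (beta < 0)%R -> good_k S alpha beta 0.
Proof.
intros H; eexists; split.
- exists (fun _ => False), (fun _ => False), (fun _ => False).
  split; [apply cut_of_closed with (P := fun _ => False); tauto|].
  split; [exists nil; split; [constructor|split; [reflexivity|simpl; tauto]]|].
  split; [reflexivity|].
  split; intros x y [[]|[]].
- apply Rbar_lt_min; (eapply Rbar_lt_le_trans; [|apply Span_ge0]); simpl; lra.
Qed.

(** An empty side has [Span] at most 0, which forces [beta + 2 < 0]; two nonempty sides separated by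
    nothing show that R(S) is disconnected. *)
Lemma good_0_of_good_0 (S : pset) (alpha beta : R) : (beta <= 3)%R ->
  good_k (Rtoom S) alpha (beta + 2) 0 -> good_k S alpha beta 0.
Proof.
intros Hb (m & (C & A1 & A2 & HC & (l & _ & Hl & HCl) & -> & _) & Hm).
destruct l; [clear Hl|discriminate].
destruct HC as (_ & A1T & A2T & _ & _ & _ & Hcut).
assert (nC : forall x, ~ C x) by (intros x Cx; apply HCl in Cx; destruct Cx).
apply Rbar_lt_min_inv in Hm; destruct Hm as [B1 B2].
assert (empty : forall A : pset, (forall x, ~ A x) ->
  Rbar_lt (alpha * INR 0 + (beta + 2))%R (Span (setU A C)) -> (beta < 0)%R).
{ intros A nA HA.
  assert (K : Rbar_lt (alpha * INR 0 + (beta + 2))%R 0).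
  { apply (Rbar_lt_le_trans _ _ _ HA), Span_empty.
    intros x [Ax|Cx]; [exact (nA x Ax)|exact (nC x Cx)]. }
  simpl in K; lra. }
destruct (classic (exists x, A1 x)) as [[x Ax]|N].
2:{ apply good_0_empty, (empty A1); eauto. }
destruct (classic (exists x, A2 x)) as [[y Ay]|N].
2:{ apply good_0_empty, (empty A2); eauto. }
apply good_0_disconnected; auto; rewrite <- connected_conn_by; intros K.
destruct (K x y) as (q & Hq & Hlast); auto.
assert (E : List.Exists C (x :: q)) by (apply Hcut; auto; rewrite Hlast; auto).
apply Exists_exists in E; destruct E as (z & _ & Cz); exact (nC z Cz).
Qed.

Lemma good_k_Rtoom (S : pset) (alpha beta : R) (k : nat) : (beta <= 3)%R ->
  good_k (Rtoom S) alpha (beta + 2) k ->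
  exists j, (j <= k)%nat /\ good_k S alpha beta j.
Proof.
intros Hb Hk.
destruct (Nat.eq_dec k 0) as [->|kpos].
{ exists 0%nat; split; [lia|apply good_0_of_good_0; auto]. }
destruct (classic (conn_by adj (Rtoom S))) as [conn_T|N].
2:{ exists 0%nat; split; [lia|apply good_0_disconnected; auto]. }
destruct (tile_cut_of_good S alpha beta k conn_T ltac:(lia) Hk) as (A1 & A2 & l & Hl & Hcut).
destruct (Rlt_le_dec (alpha + beta) 6) as [Hab|Hab].
{ exists 1%nat; split; [lia|].
  destruct l as [|p l]; [simpl in Hl; lia|].
  destruct (Rtoom_point S p) as (v & _ & Sv).
  { apply Hcut; right; left; left; auto. }
  exact (good_1_point S alpha beta v Sv Hab). }
(* The minimum is over positive lengths only, as splitting never produces an empty cut set. *)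
set (P := fun n => (0 < n)%nat /\ exists A1 A2 l, length l = n /\
  tile_cut S A1 A2 l (alpha * INR n + beta + 2)).
destruct (nat_least P k) as (n & Hn & (npos & B1 & B2 & l' & <- & Hcut') & Hmin).
{ split; [lia|eauto 6]. }
assert (minimal : forall A1' A2' l'', (0 < length l'' < length l')%nat ->
  ~ tile_cut S A1' A2' l'' (alpha * INR (length l'') + beta + 2)).
{ intros A1' A2' l'' [H1 H2] K; apply (Hmin _ H2); split; [auto|eauto 6]. }
(* From [6 <= alpha + beta] and [beta <= 3]. *)
assert (Ha : (0 <= alpha)%R) by lra.
pose proof (tile_cut_sym _ _ _ _ _ Hcut') as Hcut''.
destruct (good_k_of_tile_cut S B1 B2 l' alpha beta) as (j & Hj & K); auto.
- eapply minimal_touch_conn; eauto.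
- eapply minimal_touch_conn; eauto.
- intros p lp; eapply minimal_touches; eauto.
- intros p lp; eapply minimal_touches; eauto.
- exists j; split; [lia|auto].
Qed.

(** Well-ordering of the naturals makes the property given to [epsilon] satisfiable. *)
Lemma vartheta_spec (S : pset) (alpha beta : R) (k : nat) :
  vartheta S alpha beta = Some k ->
  good_k S alpha beta k /\ forall j, (j < k)%nat -> ~ good_k S alpha beta j.
Proof.
unfold vartheta; destruct (excluded_middle_informative _) as [[n Hn]|]; [|discriminate].
intros H; injection H as <-.
apply (epsilon_spec (inhabits 0%nat) (fun k => good_k S alpha beta k /\
  forall j, (j < k)%nat -> ~ good_k S alpha beta j)).
destruct (nat_least _ _ Hn) as (m & _ & K); eauto.
Qed.

Theorem theorem3p5 (S : pt -> Prop) (alpha beta : R) :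
  (beta <= 3 * 2 - 3)%R ->
  oge (vartheta (Rtoom S) alpha (beta + 2)%R) (vartheta S alpha beta).
Proof.
intros Hb.
destruct (vartheta (Rtoom S) alpha (beta + 2)) as [k|] eqn:E1; [|exact I].
destruct (good_k_Rtoom S alpha beta k ltac:(lra) (proj1 (vartheta_spec _ _ _ _ E1)))
  as (j & Hj & Gj).
destruct (vartheta S alpha beta) as [n|] eqn:E2.
- simpl; apply Nat.le_trans with j; auto.
  apply Nat.nlt_ge; intros Hlt; exact (proj2 (vartheta_spec _ _ _ _ E2) j Hlt Gj).
- unfold vartheta in E2; destruct (excluded_middle_informative _) as [|N]; [discriminate|].
  apply N; eauto.
Qed.
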